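(* Let $S$ be the multiset consisting of $4$ copies of each odd positive integer together with $4$ additional copies of each odd positive multiple of $5$, and let $T$ be the multiset consisting of $4$ copies of each even positive integer together with $4$ additional copies of each even positive multiple of $5$ (all copies distinct). Let $D_S(N)$ be the number of partitions of $N$ into distinct elements of $S$ having an odd number of parts, and $D_T(N)$ the number of partitions of $N$ into distinct elements of $T$. Then for every $N\ge 3$, $D_S(N)=8D_T(N-3)$.
   Context: A partition of $N$ into distinct elements of a multiset is a finite set of distinct elements of it (different copies of the same integer count as distinct elements) whose values sum to $N$. $D_T(0)=1$. *)

(* Defs.v *)
From mathcomp Require Import all_boot.
Set Implicit Arguments. Unset Strict Implicit. Unset Printing Implicit Defensive.

(* A multiset of positive integers is given by a multiplicity function
   mult : nat -> nat (mult v = number of copies of v; mult 0 = 0).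
   All multiplicities used here are at most 8. *)

Definition multS (v : nat) : nat :=
  if odd v then (if 5 %| v then 8 else 4) else 0.

Definition multT (v : nat) : nat :=
  if (0 < v) && ~~ odd v then (if 5 %| v then 8 else 4) else 0.

(* Distinct copies of values v <= N: pairs (v, i) with i < mult v
   (copy index i < 8 suffices since mult v <= 8 here). Parts larger than N
   can never occur in a partition of N, so this loses nothing. *)
Definition copy (mult : nat -> nat) (N : nat) : finType :=
  {x : 'I_N.+1 * 'I_8 | x.2 < mult x.1}.

Definition copy_val (mult : nat -> nat) (N : nat) (x : copy mult N) : nat :=
  nat_of_ord (val x).1.

Definition partitions (mult : nat -> nat) (N : nat) : {set {set copy mult N}} :=
  [set A : {set copy mult N} | \sum_(x in A) copy_val x == N].

Definition Dpart (mult : nat -> nat) (N : nat) : nat :=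
  #|partitions mult N|.

Definition Dpart_odd (mult : nat -> nat) (N : nat) : nat :=
  #|[set A in partitions mult N | odd #|A|]|.

(* Main.v *)
(* Let F(q) = prod (1 + q^(2i+1))^4 (1 + q^(5(2i+1)))^4 and
   G(q) = prod (1 + q^(2i+2))^4 (1 + q^(5(2i+2)))^4.  Counting odd subsets of S amounts to
   taking (F(q) - F(-q))/2, so everything follows from F(q) - F(-q) = 8 q + 16 q^3 G(q), which
   is the modular equation of degree 5.

   Put phi(q) = sum q^(j^2) and psi(q) = sum q^(j^2+j), with j over the integers.  For
   X = phi(q)^2 and Y = phi(q^5)^2, split the lattice sum X over Z^2 by the residue mod 5 of
   v1 + 2 v2: the zero residue gives Y, and the four others give one common series T, by
   the rotation of order 4.  Thus X - Y = 4 T, while 5 Y - X = 4 (Y - T) is four times the sum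
   of X twisted by a fifth root of unity.  Both T and Y - T are products of two one-dimensional
   theta series, and the triple product gives (X - Y)(5Y - X) = 16 q H with
   H = prod (1 - q^(2i))^2 (1 - q^(10i))^2.  The same argument applies to psi, and q -> -q
   gives a third relation.  Jacobi's quartic phi(q)^4 = phi(-q)^4 + q psi(q)^4, at q and q^5,
   cancels the squares in the signed sum of the three relations, which leaves the modular
   equation times 6 H.

   Formal power series are avoided by working in an arbitrary commutative ring with a nilpotent
   element x in place of q, finally in the quotient of the polynomial ring by X^K. *)
Require Import Defs.
From mathcomp Require Import all_boot.
From mathcomp Require Import all_order all_algebra all_field.
From mathcomp Require Import zify ring.
Set Implicit Arguments. Unset Strict Implicit. Unset Printing Implicit Defensive.
Import GRing.Theory Num.Theory.
Local Open Scope ring_scope.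

(** * Jacobi's triple product *)

Section GaussianBinomials.
Variables (A : comPzRingType) (Q : A).

(** Gaussian binomials through the q-Pascal rule, which avoids division in a general ring. *)
Fixpoint gbin (n k : nat) : A :=
  match n, k with
  | _, 0 => 1
  | 0, _.+1 => 0
  | n'.+1, k'.+1 => Q ^+ k'.+1 * gbin n' k'.+1 + gbin n' k'
  end.

(** The q-Pochhammer symbol $(Q;Q)_n$. *)
Definition qfact n := \prod_(i < n) (1 - Q ^+ i.+1).

Arguments gbin : simpl never.

Lemma gbin0 n : gbin n 0 = 1. Proof. by case: n. Qed.

Lemma gbinS n k : gbin n.+1 k.+1 = Q ^+ k.+1 * gbin n k.+1 + gbin n k.
Proof. by []. Qed.

Lemma gbin_small n k : (n < k)%N -> gbin n k = 0.
Proof.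
elim: n k => [|n IH] [|k] // nk; rewrite gbinS !IH ?mulr0 ?addr0 //; lia.
Qed.

(** The mirror q-Pascal rule: [gbinS] serves the induction on [b] in [finite_triple_product], this
    one the induction on [a]. *)
Lemma gbinS' n k : (k <= n)%N ->
  gbin n.+1 k.+1 = gbin n k.+1 + Q ^+ (n - k) * gbin n k.
Proof.
elim: n k => [|n IH] k kn; first by case: k kn => // _; rewrite gbinS gbin0 /gbin; ring.
case: k kn => [|k] kn.
  rewrite (gbinS n.+1 0) {1}(IH 0%N) // (gbinS n 0) !gbin0 !subn0 !exprS; ring.
have [->|kn'] : k = n \/ (k < n)%N by lia.
  rewrite subnn !(gbinS n.+1) (@gbin_small n.+1 n.+2) //; ring.
rewrite (gbinS n.+1 k.+1) {1}(IH k.+1) // {1}(IH k) ?(ltnW kn') // (gbinS n k.+1) (gbinS n k).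
have -> : (n - k.+1 = (n - k).-1)%N by lia.
have -> : (n.+1 - k.+1 = (n - k).-1.+1)%N by lia.
have {2}-> : (n - k = (n - k).-1.+1)%N by lia.
rewrite !exprS; ring.
Qed.

Lemma qfactS n : qfact n.+1 = qfact n * (1 - Q ^+ n.+1).
Proof. by rewrite /qfact big_ord_recr. Qed.

Lemma gbin_qfact a b : gbin (a + b) a * qfact a * qfact b = qfact (a + b).
Proof.
elim: a b => [|a IHa] b; first by rewrite gbin0 /qfact big_ord0 mulr1 mul1r.
elim: b => [|b IHb].
  rewrite addn0 gbinS gbin_small // mulr0 add0r !qfactS.
  have := IHa 0%N; rewrite addn0 /qfact big_ord0 !mulr1 => E.
  by rewrite mulrA E.
have := IHa b.+1; rewrite addnS => {}IHa; rewrite addSn in IHb.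
rewrite addSn addnS gbinS (qfactS (a + b).+1).
have -> : Q ^+ (a + b).+2 = Q ^+ a.+1 * Q ^+ b.+1 by rewrite -exprD; congr (_ ^+ _); lia.
transitivity (Q ^+ a.+1 * (1 - Q ^+ b.+1) * (gbin (a + b).+1 a.+1 * qfact a.+1 * qfact b) +
  (1 - Q ^+ a.+1) * (gbin (a + b).+1 a * qfact a * qfact b.+1)).
  rewrite !qfactS; ring.
rewrite IHb IHa; ring.
Qed.
End GaussianBinomials.
Arguments gbin {A} Q n k : simpl never.

(* The triangular number j (j + 1) / 2 of an integer j. *)
Definition tri (j : int) : nat := match j with Posz n | Negz n => 'C(n.+1, 2) end.

Lemma triE j : (tri j)%:Z * 2 = j * (j + 1).
Proof.
have binE n : ('C(n.+1, 2) * 2 = n.+1 * n)%N.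
  by rewrite -[X in (_ * X)%N]/(2`!)%N bin_ffact ffactnS ffactn1.
case: j => n /=; last rewrite NegzE.
  have := binE n; nia.
have := binE n; nia.
Qed.

(** * The finite form of the triple product *)

Section TripleProduct.
Variables (A : comPzRingType) (u w : A).
Let Q := u * w.

(** As [tri (- j)] is $j(j-1)/2$, this is the general term of Ramanujan's $f(u,w)$. *)
Definition theta_term j := u ^+ tri j * w ^+ tri (- j).
Local Notation t := theta_term.

Lemma theta_termS n : t n.+1 = t n * (u * Q ^+ n).
Proof.
rewrite /t /Q exprMn.
have -> : (tri n.+1%:Z = tri n + n.+1)%N by have := triE n; have := triE n.+1; lia.
have -> : (tri (- n.+1%:Z) = tri (- n%:Z) + n)%N by have := triE (- n%:Z); have := triE (- n.+1%:Z); lia.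
rewrite !exprD exprS; ring.
Qed.

Lemma theta_termN n : t (- n.+1%:Z) = t (- n%:Z) * (w * Q ^+ n).
Proof.
rewrite /t /Q exprMn !opprK.
have -> : (tri n.+1%:Z = tri n + n.+1)%N by have := triE n; have := triE n.+1; lia.
have -> : (tri (- n.+1%:Z) = tri (- n%:Z) + n)%N by have := triE (- n%:Z); have := triE (- n.+1%:Z); lia.
rewrite !exprD exprS; ring.
Qed.

(** The power of [Q] on the right is exactly the weight occurring in [gbinS']. *)
Lemma theta_term_up a b k : (k <= a + b)%N ->
  u * Q ^+ a * t (k%:Z - b%:Z) = Q ^+ (a + b - k) * t (k.+1%:Z - b%:Z).
Proof.
move=> kab; case: (leqP b k) => bk.
  have -> : k.+1%:Z - b%:Z = (k - b).+1 by lia.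
  have -> : k%:Z - b%:Z = (k - b)%N by lia.
  rewrite theta_termS; have {1}-> : a = (a + b - k + (k - b))%N by lia.
  rewrite exprD; ring.
have -> : k%:Z - b%:Z = - (b - k.+1).+1%:Z by lia.
have -> : k.+1%:Z - b%:Z = - (b - k.+1)%N%:Z by lia.
rewrite theta_termN; have -> : (a + b - k = a + (b - k.+1).+1)%N by lia.
rewrite exprD exprS; move: (Q ^+ a) (Q ^+ _) => p r; rewrite /Q; ring.
Qed.

Lemma theta_term_down b k : (k <= b)%N ->
  w * Q ^+ b * t (k%:Z - b%:Z) = Q ^+ k * t (k%:Z - b.+1%:Z).
Proof.
move=> kab.
have -> : k%:Z - b%:Z = - (b - k)%N%:Z by lia.
have -> : k%:Z - b.+1%:Z = - (b - k).+1%:Z by lia.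
rewrite theta_termN; have {1}-> : b = (k + (b - k))%N by lia.
rewrite exprD; ring.
Qed.

(** Each new factor splits the sum in two and a q-Pascal rule recombines the halves: first for
    [a = 0] by induction on [b], then by induction on [a]. *)
Lemma finite_triple_product a b :
  \prod_(i < a) (1 + u * Q ^+ i) * \prod_(i < b) (1 + w * Q ^+ i) =
  \sum_(k < (a + b).+1) gbin Q (a + b) k * t (k%:Z - b%:Z).
Proof.
elim: a => [|a IH].
  rewrite big_ord0 mul1r add0n; elim: b => [|b IH].
    by rewrite big_ord0 big_ord_recl big_ord0 /= /t /= !mulr1 addr0.
  rewrite big_ord_recr /= IH mulrDr mulr1 [RHS]big_ord_recl.
  under [in RHS]eq_bigr do rewrite lift0 gbinS mulrDl.
  rewrite big_split [RHS]addrA [RHS]addrC; congr (_ + _).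
    apply: eq_bigr => k _; congr (_ * t _); lia.
  rewrite mulr_suml big_ord_recl [in RHS]big_ord_recr /= (@gbin_small _ _ b b.+1) // mulr0 mul0r addr0.
  congr (_ + _).
    by rewrite !gbin0 !mul1r mulrC theta_term_down // expr0 mul1r.
  apply: eq_bigr => k _; rewrite /bump leq0n add1n -mulrA (mulrC (t _)) theta_term_down; last by have := ltn_ord k; lia.
  ring.
rewrite big_ord_recr /= mulrAC IH mulrDr mulr1 addSn [RHS]big_ord_recl.
under [in RHS]eq_bigr => k _.
  rewrite lift0 gbinS'; last by have := ltn_ord k; lia.
  rewrite mulrDl; over.
rewrite big_split /= addrA; congr (_ + _).
  rewrite [in RHS]big_ord_recr /= (@gbin_small _ _ (a + b) (a + b).+1) // mul0r addr0 big_ord_recl !gbin0.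
  by congr (_ + _).
rewrite mulr_suml; apply: eq_bigr => k _.
rewrite -[LHS]mulrA (mulrC (t _)) theta_term_up; last by have := ltn_ord k; lia.
ring.
Qed.

End TripleProduct.

(** * Nilpotent elements and the full triple product *)

Lemma unit_1Bnilp (A : comUnitRingType) (z : A) n : z ^+ n = 0 -> 1 - z \is a GRing.unit.
Proof.
move=> zn; apply/unitrPr; exists (\sum_(i < n) z ^+ i).
by have := subrX1 z n; rewrite zn sub0r -(opprB 1 z) mulNr => /oppr_inj.
Qed.

Lemma nilp_ge (A : pzSemiRingType) (z : A) m n : z ^+ m = 0 -> (m <= n)%N -> z ^+ n = 0.
Proof. by move=> zm mn; rewrite -(subnKC mn) exprD zm mul0r. Qed.

Lemma qfact_unit (A : comUnitRingType) (Q : A) m n : Q ^+ m = 0 -> qfact Q n \is a GRing.unit.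
Proof.
move=> Qm; apply: unitr_prod => i _; apply: (@unit_1Bnilp _ _ m).
by rewrite -exprM mulnC exprM Qm expr0n.
Qed.

Section JacobiTripleProduct.
Variables (A : comUnitRingType) (u w : A) (m : nat).
Hypothesis nilp : (u * w) ^+ m = 0.
Let Q := u * w.

Lemma qfact_addn n d : exists r, qfact Q (n + d) = qfact Q n * (1 + Q ^+ n.+1 * r).
Proof.
elim: d => [|d [r IH]]; first by exists 0; rewrite addn0; ring.
exists (r - Q ^+ d * (1 + Q ^+ n.+1 * r)).
rewrite addnS qfactS IH -addnS -addSnnS exprD; ring.
Qed.

(** Terms far from the centre carry a high power of [Q], which makes up for the weak estimate of
    [gbin_limit] there. *)
Lemma theta_term_factor d j : `|j|%N = d -> exists r, theta_term u w j = Q ^+ 'C(d, 2) * r.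
Proof.
case: d => [|d] jd; first by exists (theta_term u w j); rewrite expr0 mul1r.
have [->|->] : j = d.+1 \/ j = - d.+1%:Z by lia.
  elim: d {jd} => [|d [r IH]]; first by exists (theta_term u w 1%N); rewrite expr0 mul1r.
  by exists (r * u); rewrite theta_termS IH [in RHS]binS bin1 exprD /Q; ring.
elim: d {jd} => [|d [r IH]]; first by exists (theta_term u w (- 1%N%:Z)); rewrite expr0 mul1r.
by exists (r * w); rewrite theta_termN IH [in RHS]binS bin1 exprD /Q; ring.
Qed.

(** By [gbin_qfact] the left sides are quotients of values of [qfact] at indices at least [m - d],
    and such values agree up to a factor $1+O(Q^{m-d+1})$. *)
Lemma gbin_limit d : (d <= m)%N -> exists r,
  gbin Q (m + m) (m + d) * qfact Q m = 1 + Q ^+ (m - d).+1 * r /\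
  gbin Q (m + m) (m - d) * qfact Q m = 1 + Q ^+ (m - d).+1 * r.
Proof.
move=> dm; have [r1 E1] := qfact_addn (m + d) (m - d).
have [r2 E2] := qfact_addn (m - d) d.
exists (Q ^+ (d + d) * r1 + r2 + Q ^+ (d + d) * r1 * (Q ^+ (m - d).+1 * r2)).
have e : ((m + d).+1 = (m - d).+1 + (d + d))%N by lia.
have F1 := gbin_qfact Q (m + d)%N (m - d)%N; have F2 := gbin_qfact Q (m - d)%N (m + d)%N.
rewrite (addnC (m - d)%N (m + d)%N) in F2.
rewrite e exprD in E1; rewrite subnK // in E2.
rewrite (_ : (m + d + (m - d) = m + m)%N) in E1 F1 F2; last by lia.
split; rewrite E2; apply: (mulrI (qfact_unit (m + d) nilp)).
  transitivity (gbin Q (m + m) (m + d) * qfact Q (m + d) * qfact Q (m - d) * (1 + Q ^+ (m - d).+1 * r2)).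
    ring.
  rewrite F1 E1; ring.
transitivity (gbin Q (m + m) (m - d) * qfact Q (m - d) * qfact Q (m + d) * (1 + Q ^+ (m - d).+1 * r2)).
  ring.
rewrite F2 E1; ring.
Qed.

(* Ramanujan's f(u, w); nilpotency of u w makes the omitted terms vanish. *)
Definition theta : A := \sum_(k < (m + m).+1) theta_term u w (k%:Z - m%:Z).

Lemma triple_product : theta =
  qfact Q m * \prod_(i < m) ((1 + u * Q ^+ i) * (1 + w * Q ^+ i)).
Proof.
rewrite big_split /= /Q finite_triple_product -/Q mulr_sumr; apply: eq_bigr => k _.
set d := `|k%:Z - m%:Z|%N.
have dm : (d <= m)%N by have := ltn_ord k; lia.
have [r [G1 G2]] := gbin_limit dm; have [s ->] := theta_term_factor (erefl d).
have {G1 G2} G : gbin Q (m + m) k * qfact Q m = 1 + Q ^+ (m - d).+1 * r.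
  by have [->|->] : (nat_of_ord k = m + d \/ nat_of_ord k = m - d)%N by lia.
rewrite mulrA (mulrC (qfact _ _)) G.
(* Since $d(d-1)/2 \ge d-1$, the total exponent is at least [m]. *)
suff Z : Q ^+ (m - d).+1 * Q ^+ 'C(d, 2) = 0.
  rewrite (_ : (1 + _) * _ = Q ^+ 'C(d, 2) * s + Q ^+ (m - d).+1 * Q ^+ 'C(d, 2) * (r * s)).
    by rewrite Z mul0r addr0.
  ring.
rewrite -exprD; apply: nilp_ge nilp _.
have := bin2 d; case: (d) => [|[|[|e]]]; rewrite ?bin2 //=; try lia.
Qed.
End JacobiTripleProduct.

(** * Lattice sums *)

(** Stands in for a bijective change of variables in an infinite lattice sum: [h] and [k] need not
    carry the finite windows [r] and [s] to each other, because terms outside them vanish. *)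
Lemma big_reindex_supp (V : zmodType) (I J : eqType) (r : seq I) (s : seq J)
    (P : pred I) (R : pred J) (F : I -> V) (G : J -> V) (h : I -> J) (k : J -> I) :
    uniq r -> uniq s ->
    (forall i, P i -> i \notin r -> F i = 0) ->
    (forall j, R j -> j \notin s -> G j = 0) ->
    (forall i, P i -> [/\ R (h i), k (h i) = i & G (h i) = F i]) ->
    (forall j, R j -> P (k j) /\ h (k j) = j) ->
  \sum_(i <- r | P i) F i = \sum_(j <- s | R j) G j.
Proof.
move=> Ur Us Fr Gs hP kR.
have nz (T : eqType) (t : seq T) (B : pred T) (H : T -> V) :
    \sum_(i <- t | B i) H i = \sum_(i <- [seq i <- t | B i && (H i != 0)]) H i.
  rewrite big_filter big_mkcond [RHS]big_mkcond; apply: eq_bigr => i _.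
  by case: (B i); case: eqP.
rewrite nz [RHS]nz.
rewrite (@perm_big _ _ _ _ [seq j <- s | _] [seq h i | i <- [seq i <- r | P i && (F i != 0)]]).
  rewrite big_map !big_filter; apply: eq_bigr => i /andP[/hP[_ _ ->]] //.
apply: uniq_perm; rewrite ?filter_uniq //.
  rewrite map_inj_in_uniq ?filter_uniq // => i i'; rewrite !mem_filter.
  move=> /andP[/andP[/hP[_ hi _] _] _] /andP[/andP[/hP[_ hi' _] _] _] e.
  by rewrite -hi e hi'.
move=> j; rewrite mem_filter; apply/idP/mapP.
  move=> /andP[/andP[Rj Gj] sj]; have [Pk hk] := kR _ Rj; exists (k j) => //.
  have [_ _ Gk] := hP _ Pk; rewrite mem_filter Pk -Gk hk Gj /=.
  by apply: contraT => /(Fr _ Pk) F0; rewrite -Gk hk in F0; rewrite F0 eqxx in Gj.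
move=> [i]; rewrite mem_filter => /andP[/andP[Pi Fi] ri] ->.
have [Rh _ Gh] := hP _ Pi; rewrite Rh Gh Fi /=.
by apply: contraT => /(Gs _ Rh) G0; rewrite -Gh G0 eqxx in Fi.
Qed.

Definition box (m : nat) : seq int := [seq i%:Z - m%:Z | i <- iota 0 (m + m).+1].

Lemma mem_box m (j : int) : (j \in box m) = (`|j| <= m)%N.
Proof.
apply/mapP/idP => [[i]|jm]; first by rewrite mem_iota => ? ->; lia.
by exists (absz (j + m%:Z)%R); rewrite ?mem_iota; lia.
Qed.

Lemma box_uniq m : uniq (box m).
Proof. by rewrite map_inj_uniq ?iota_uniq // => i j; lia. Qed.

Definition box2 m := [seq (i, j) | i <- box m, j <- box m].

Lemma mem_box2 m v : (v \in box2 m) = (`|v.1| <= m)%N && (`|v.2| <= m)%N.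
Proof.
case: v => i j; rewrite -!mem_box; apply/allpairsP/andP => [[p [? ? [-> ->]]] //|[? ?]].
by exists (i, j).
Qed.

Lemma box2_uniq m : uniq (box2 m).
Proof. by apply: allpairs_uniq; rewrite ?box_uniq // => -[? ?] [? ?]. Qed.

Lemma theta_box (A : comUnitRingType) (u w : A) m :
  theta u w m = \sum_(j <- box m) theta_term u w j.
Proof. by rewrite /theta big_map -(big_mkord xpredT (fun k => theta_term u w (k%:Z - m%:Z))). Qed.

Lemma big_box2 (A : comUnitRingType) m (F G : int -> A) :
  (\sum_(j <- box m) F j) * (\sum_(j <- box m) G j) =
  \sum_(v <- box2 m) F v.1 * G v.2.
Proof. by rewrite big_allpairs big_distrlr. Qed.

Lemma theta_termX (A : comPzRingType) (x : A) (a b : nat) (j n : int) :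
  n * 2 = a%:Z * (j * (j + 1)) + b%:Z * (j * (j - 1)) ->
  theta_term (x ^+ a) (x ^+ b) j = x ^+ `|n|%N.
Proof.
move=> nE; rewrite /theta_term -!exprM -exprD; congr (_ ^+ _).
suff : (a * tri j + b * tri (- j))%N = n :> int by move=> /(congr1 absz).
by have := triE j; have := triE (- j); nia.
Qed.

(** * Dissection of the lattice sums modulo 5 *)

Section Dissection.
(* e = 0 treats phi and e = 1 treats psi. *)
Variables (A : comUnitRingType) (x : A) (K e : nat).
Hypotheses (xK : x ^+ K = 0) (e01 : (e <= 1)%N).

Let e_cases : e = 0%N \/ e = 1%N. Proof. lia. Qed.

Definition qform (v : int * int) : int :=
  v.1 * v.1 + e%:Z * v.1 + (v.2 * v.2 + e%:Z * v.2).

(** Growth that pushes the exponent up to [K] outside the box. The loss of 1 is forced by [i = -1],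
    [e = 1], and is harmless because a coordinate outside has absolute value at least [K + 1]. *)
Lemma sq_ge (i : int) : 0 <= i * i + e%:Z * i /\ `|i| - 1 <= i * i + e%:Z * i.
Proof. by case: e_cases => ->; case: i => n; rewrite ?NegzE; split; nia. Qed.

Lemma qform_ge0 v : 0 <= qform v.
Proof. by rewrite /qform; have := sq_ge v.1; have := sq_ge v.2; lia. Qed.

Lemma qform_supp v : v \notin box2 K -> x ^+ `|qform v|%N = 0.
Proof.
rewrite mem_box2 => vK; apply: nilp_ge xK _; move: vK.
have := sq_ge v.1; have := sq_ge v.2; rewrite /qform.
by move: (v.1 * v.1 + _) (v.2 * v.2 + _) => a b; lia.
Qed.

(** Subtracting [e] makes the linear form vanish modulo 5 at the centre $(-e/2,-e/2)$, as $-3/2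
    \equiv 1$; the rotation about it then multiplies the linear form by 2. *)
Definition slice (c : int) : A :=
  \sum_(v <- box2 K | (5 %| v.1 + 2 * v.2 - e%:Z - c)%Z) x ^+ `|qform v|%N.

(* The rotation by a right angle, about the centre (-e/2, -e/2) of the form. *)
Lemma slice_rot c : slice c = slice (2 * c).
Proof.
apply: (@big_reindex_supp _ _ _ _ _ _ _ _ _
  (fun v => (- v.2 - e%:Z, v.1)) (fun v => (v.2, - v.1 - e%:Z))); rewrite ?box2_uniq //.
- by move=> v _; apply: qform_supp.
- by move=> v _; apply: qform_supp.
- move=> [i j] /= ij; split; [lia | congr (_, _); lia | congr (_ ^+ `| _ |%N)].
  rewrite /qform /=; ring.
by move=> [i j] /= ij; split; [lia | congr (_, _); lia].
Qed.

Lemma qform5_supp v : v \notin box2 K -> x ^+ `|(5 * qform v + 2 * e%:Z)%R|%N = 0.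
Proof.
rewrite mem_box2 => vK; apply: nilp_ge xK _; move: vK.
have := sq_ge v.1; have := sq_ge v.2; rewrite /qform.
by move: (v.1 * v.1 + _) (v.2 * v.2 + _) => a b; lia.
Qed.

(** The substitution is a similarity of ratio $\sqrt 5$ and determinant $-5$, whose image is exactly
    the zero residue class. *)
Lemma slice0 : slice 0 = \sum_(v <- box2 K) x ^+ `|(5 * qform v + 2 * e%:Z)%R|%N.
Proof.
symmetry; apply: (@big_reindex_supp _ _ _ _ _ _ _ _ _
  (fun v => (v.1 + 2 * v.2 + e%:Z, 2 * v.1 - v.2))
  (fun v => ((v.1 + 2 * v.2 - e%:Z) %/ 5, (2 * v.1 - v.2 - 2 * e%:Z) %/ 5)%Z));
  rewrite ?box2_uniq //.
- by move=> v _; apply: qform5_supp.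
- by move=> v _; apply: qform_supp.
- move=> [i j] /= _; split; [lia | congr (_, _); lia | congr (_ ^+ `| _ |%N)].
  by rewrite /qform /=; case: e_cases => ->; ring.
by move=> [i j] /= ij; split; [lia | congr (_, _); lia].
Qed.

(** [qform], less the constant [1 - e], after the substitution of [slice0] moved by -1 in the first
    coordinate. Cross terms cancel, so the slice becomes a product of two one-dimensional series. *)
Definition qform1 (v : int * int) : int :=
  5 * (v.1 * v.1) + (5 * e%:Z - 2) * v.1 + (5 * (v.2 * v.2) + (5 * e%:Z - 4) * v.2).

Lemma sq1_ge (i : int) : `|i| <= 5 * (i * i) + (5 * e%:Z - 2) * i /\
  `|i| <= 5 * (i * i) + (5 * e%:Z - 4) * i.
Proof. by case: e_cases => ->; case: i => n; rewrite ?NegzE; split; nia. Qed.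

Lemma qform1_supp v : v \notin box2 K -> x ^+ `|(qform1 v + (1 - e%:Z))%R|%N = 0.
Proof.
rewrite mem_box2 => vK; apply: nilp_ge xK _; move: vK.
have := sq1_ge v.1; have := sq1_ge v.2; rewrite /qform1.
by move: (5 * (v.1 * v.1) + (_ - 2) * _) (5 * (v.2 * v.2) + (_ - 4) * _) => a b; lia.
Qed.

Lemma slice1 : slice (-1) = \sum_(v <- box2 K) x ^+ `|(qform1 v + (1 - e%:Z))%R|%N.
Proof.
symmetry; apply: (@big_reindex_supp _ _ _ _ _ _ _ _ _
  (fun v => (v.1 + 2 * v.2 + e%:Z - 1, 2 * v.1 - v.2))
  (fun v => ((v.1 + 2 * v.2 - e%:Z + 1) %/ 5, (2 * v.1 - v.2 - 2 * e%:Z + 2) %/ 5)%Z));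
  rewrite ?box2_uniq //.
- by move=> v _; apply: qform1_supp.
- by move=> v _; apply: qform_supp.
- move=> [i j] /= _; split; [lia | congr (_, _); lia | congr (_ ^+ `| _ |%N)].
  by rewrite /qform /qform1 /=; case: e_cases => ->; ring.
by move=> [i j] /= ij; split; [lia | congr (_, _); lia].
Qed.

(** A weight of period 5 is constant on each slice. It is applied to the weight 1 and to powers of a
    fifth root of unity. *)
Lemma sum_slices (g : int -> A) : (forall i, g (i + 5) = g i) ->
  \sum_(v <- box2 K) g (v.1 + 2 * v.2 - e%:Z) * x ^+ `|qform v|%N =
  g 0 * slice 0 + (g 1 + g 2 + g 3 + g 4) * slice (-1).
Proof.
move=> g5; have g5n i (n : nat) : g (i + 5 * n%:Z) = g i.
  elim: n => [|n IH]; first by rewrite mulr0 addr0.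
  by rewrite -[RHS]IH -[RHS]g5; congr g; lia.
have g5z i n : g (i + 5 * n) = g i.
  case: (n) => m; first exact: g5n.
  by rewrite -(g5n _ m.+1); congr g; lia.
have eqs c d : (5 %| c - d)%Z -> slice c = slice d.
  by move=> cd; apply: eq_bigl => v; lia.
(* 2 generates the units modulo 5, so [slice_rot] identifies all four nonzero slices. *)
have S4 : slice 4 = slice (-1) by apply: eqs.
have S3 : slice 3 = slice (-1) by rewrite -S4 [RHS]slice_rot; apply: eqs.
have S2 : slice 2 = slice (-1) by rewrite slice_rot; apply: eqs.
have S1 : slice 1 = slice (-1) by rewrite slice_rot -S2; apply: eqs.
transitivity (g 0 * slice 0 + g 1 * slice 1 + g 2 * slice 2 + g 3 * slice 3 + g 4 * slice 4);
  last by rewrite S1 S2 S3 S4; ring.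
have sliceE c : slice c = \sum_(v <- box2 K)
    if (5 %| v.1 + 2 * v.2 - e%:Z - c)%Z then x ^+ `|qform v|%N else 0 by rewrite /slice big_mkcond.
rewrite !sliceE !mulr_sumr -!big_split /=; apply: eq_bigr => v _.
set n := v.1 + _ - _; have nE := divz_eq n 5.
have [n5 n0] : (n %% 5)%Z < 5 /\ 0 <= (n %% 5)%Z by lia.
have -> : g n = g (n %% 5)%Z by rewrite {1}nE addrC mulrC g5z.
have dv c : (5 %| n - c)%Z = (5 %| (n %% 5)%Z - c)%Z by lia.
rewrite !dv; move: n5 n0; move: (n %% 5)%Z => m m5 m0.
have [->|[->|[->|[->|->]]]] : m = 0 \/ m = 1 \/ m = 2 \/ m = 3 \/ m = 4 by lia.
all: rewrite /=; ring.
Qed.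
End Dissection.

(** * Jacobi's quartic identity *)

Section Theta.
Variables (A : comUnitRingType) (K : nat).
Implicit Types (x z : A) (e : nat).

(* phi(x) for e = 0 and psi(x) for e = 1. *)
Definition Th e x := theta (x ^+ (1 + e)) (x ^+ (1 - e)) K.

Lemma Th_box e x : (e <= 1)%N ->
  Th e x = \sum_(j <- box K) x ^+ `|(j * j + e%:Z * j)%R|%N.
Proof.
move=> e1; rewrite /Th theta_box; apply: eq_bigr => j _; apply: theta_termX.
have [->|->] : (e = 0 \/ e = 1)%N by lia.
all: rewrite ?subn0 ?subnn ?addn0 ?addn1; ring.
Qed.

Lemma Th_sq e x : (e <= 1)%N -> Th e x ^+ 2 = \sum_(v <- box2 K) x ^+ `|qform e v|%N.
Proof.
move=> e1; rewrite expr2 Th_box // big_box2; apply: eq_bigr => v _.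
rewrite -exprD /qform; congr (_ ^+ _).
have [] := sq_ge e1 v.1; have [] := sq_ge e1 v.2; lia.
Qed.

Lemma Th_mul x : Th 0 x * Th 1 x =
  \sum_(v <- box2 K) x ^+ `|(v.1 * v.1 + (v.2 * v.2 + v.2))%R|%N.
Proof.
rewrite !Th_box // big_box2; apply: eq_bigr => v _.
by rewrite -exprD; congr (_ ^+ _); have [] := @sq_ge 1 isT v.2; nia.
Qed.

Lemma nilp_exp x n : x ^+ K = 0 -> (0 < n)%N -> (x ^+ n) ^+ K = 0.
Proof. by move=> xK n0; rewrite -exprM; apply: nilp_ge xK _; nia. Qed.

Section Quartic.
Variable x : A.
Hypothesis xK : x ^+ K = 0.
Let x2K : (x ^+ 2) ^+ K = 0. Proof. exact: nilp_exp. Qed.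

(** Both parity classes are images of the whole lattice under similarities of ratio $\sqrt 2$, hence
    give theta series in [x ^+ 2]. *)
Definition parity_part e (b : bool) : A :=
  \sum_(v <- box2 K | (2 %| v.1 + v.2)%Z == b) x ^+ `|qform e v|%N.

Lemma parity_part0t : parity_part 0 true = Th 0 (x ^+ 2) ^+ 2.
Proof.
rewrite Th_sq //; symmetry; apply: (@big_reindex_supp _ _ _ _ _ _ _ _ _
  (fun v => (v.1 + v.2, v.1 - v.2)) (fun v => ((v.1 + v.2) %/ 2, (v.1 - v.2) %/ 2)%Z));
  rewrite ?box2_uniq //.
- by move=> v _; apply: qform_supp.
- by move=> v _; apply: qform_supp.
- move=> [i j] /= _; split; [lia | congr (_, _); lia | rewrite -exprM; congr (_ ^+ _)].
  by rewrite -[2%N]/(absz 2) -abszM; congr absz; rewrite /qform /=; ring.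
by move=> [i j] /= ij; split; [lia | congr (_, _); lia].
Qed.

Lemma parity_part0f : parity_part 0 false = x * Th 1 (x ^+ 2) ^+ 2.
Proof.
rewrite Th_sq // mulr_sumr; symmetry; apply: (@big_reindex_supp _ _ _ _ _ _ _ _ _
  (fun v => (v.1 + v.2 + 1, v.1 - v.2))
  (fun v => ((v.1 + v.2 - 1) %/ 2, (v.1 - v.2 - 1) %/ 2)%Z));
  rewrite ?box2_uniq //.
- by move=> v _ vK; rewrite (@qform_supp _ _ K) ?mulr0.
- by move=> v _; apply: qform_supp.
- move=> [i j] /= _; split; [lia | congr (_, _); lia | rewrite -exprM -exprS; congr (_ ^+ _)].
  have := @qform_ge0 1 isT (i, j); rewrite /qform /=.
  have -> : (i + j + 1) * (i + j + 1) + 0%N%:Z * (i + j + 1) + ((i - j) * (i - j) + 0%N%:Z * (i - j)) =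
    1 + 2 * (i * i + 1%N%:Z * i + (j * j + 1%N%:Z * j)) by ring.
  lia.
by move=> [i j] /= ij; split; [lia | congr (_, _); lia].
Qed.

Let mul_supp v : v \notin box2 K ->
  (x ^+ 2) ^+ `|(v.1 * v.1 + (v.2 * v.2 + v.2))%R|%N = 0.
Proof.
rewrite mem_box2 => vK; apply: nilp_ge x2K _; move: vK.
have := @sq_ge 0 isT v.1; have := @sq_ge 1 isT v.2; rewrite !mul0r !mul1r !addr0.
by move: (v.1 * v.1) (v.2 * v.2 + _) => a b; lia.
Qed.

Lemma parity_part1t : parity_part 1 true = Th 0 (x ^+ 2) * Th 1 (x ^+ 2).
Proof.
rewrite Th_mul; symmetry; apply: (@big_reindex_supp _ _ _ _ _ _ _ _ _
  (fun v => (v.1 + v.2, v.2 - v.1)) (fun v => ((v.1 - v.2) %/ 2, (v.1 + v.2) %/ 2)%Z));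
  rewrite ?box2_uniq //.
- by move=> v _; apply: mul_supp.
- by move=> v _; apply: qform_supp.
- move=> [i j] /= _; split; [lia | congr (_, _); lia | rewrite -exprM; congr (_ ^+ _)].
  by rewrite -[2%N]/(absz 2) -abszM; congr absz; rewrite /qform /=; ring.
by move=> [i j] /= ij; split; [lia | congr (_, _); lia].
Qed.

Lemma parity_part1f : parity_part 1 false = Th 0 (x ^+ 2) * Th 1 (x ^+ 2).
Proof.
rewrite Th_mul; symmetry; apply: (@big_reindex_supp _ _ _ _ _ _ _ _ _
  (fun v => (v.1 + v.2, v.1 - v.2 - 1))
  (fun v => ((v.1 + v.2 + 1) %/ 2, (v.1 - v.2 - 1) %/ 2)%Z));
  rewrite ?box2_uniq //.
- by move=> v _; apply: mul_supp.
- by move=> v _; apply: qform_supp.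
- move=> [i j] /= _; split; [lia | congr (_, _); lia | rewrite -exprM; congr (_ ^+ _)].
  by rewrite -[2%N]/(absz 2) -abszM; congr absz; rewrite /qform /=; ring.
by move=> [i j] /= ij; split; [lia | congr (_, _); lia].
Qed.

Lemma Th_sq_parity e : (e <= 1)%N -> Th e x ^+ 2 = parity_part e true + parity_part e false.
Proof.
move=> e1; rewrite Th_sq // (bigID (fun v => (2 %| v.1 + v.2)%Z)) /=.
by congr (_ + _); apply: eq_bigl => v; case: (_ %| _)%Z.
Qed.

Lemma Th0N_sq_parity : Th 0 (- x) ^+ 2 = parity_part 0 true - parity_part 0 false.
Proof.
rewrite Th_sq // (bigID (fun v => (2 %| v.1 + v.2)%Z)) /= -sumrN.
(* [triE] supplies the evenness of $i^2-i$ for both coordinates. *)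
have par v : odd `|qform 0 v|%N = ~~ (2 %| v.1 + v.2)%Z.
  by rewrite /qform; have := triE (v.1 - 1); have := triE (v.2 - 1); lia.
congr (_ + _); apply: eq_big => v; rewrite ?eqb_id ?eqbF_neg // => v2;
  by rewrite exprNn -signr_odd par ?(negbTE v2) ?v2 ?mul1r ?mulN1r.
Qed.

(** With $a, b$ the even and odd parts of $\varphi(x)^2$, the difference of fourth powers is
    $(a+b)^2-(a-b)^2=4ab=x(2\varphi(x^2)\psi(x^2))^2$, and the last bracket is $\psi(x)^2$. *)
Lemma jacobi_quartic : Th 0 x ^+ 4 = Th 0 (- x) ^+ 4 + x * Th 1 x ^+ 4.
Proof.
rewrite -[4%N]/(2 * 2)%N !exprM !Th_sq_parity // Th0N_sq_parity.
rewrite parity_part0t parity_part0f parity_part1t parity_part1f; ring.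
Qed.
End Quartic.
End Theta.

(** * Products of degree 5 *)

Lemma prod_stable (A : comPzRingType) (f : nat -> A) m n :
  (forall i, (m <= i)%N -> f i = 1) -> (m <= n)%N ->
  \prod_(i < n) f i = \prod_(i < m) f i.
Proof.
move=> f1 mn; rewrite -!(big_mkord xpredT f) (@big_cat_nat _ _ _ m) //=.
rewrite [X in _ * X]big_nat_cond [X in _ * X]big1 ?mulr1 // => i.
by rewrite andbT => /andP[mi _]; apply: f1.
Qed.

Lemma prod_blocks (A : comPzRingType) (f : nat -> A) b n :
  \prod_(i < b * n) f i = \prod_(i < n) \prod_(r < b) f (b * i + r)%N.
Proof.
elim: n => [|n IH]; first by rewrite muln0 !big_ord0.
by rewrite mulnS addnC big_split_ord /= IH [RHS]big_ord_recr.
Qed.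

Section Products.
Variables (A : comUnitRingType) (K : nat).
Implicit Types (x z : A) (e : nat).

(** [K] factors suffice: once [x ^+ K = 0], all later ones are 1. *)
Definition prod_odd x := \prod_(i < K) (1 + x ^+ (2 * i + 1)).
Definition prod_even x := \prod_(i < K) (1 + x ^+ (2 * i + 2)).
Definition euler x := qfact (x ^+ 2) K.

Lemma unit_1Dexp x n : x ^+ K = 0 -> (0 < n)%N -> 1 + x ^+ n \is a GRing.unit.
Proof.
move=> xK n0; rewrite -[_ ^+ n]opprK; apply: (@unit_1Bnilp _ _ K).
by rewrite exprNn nilp_exp ?mulr0.
Qed.

Lemma prod_odd_unit x : x ^+ K = 0 -> prod_odd x \is a GRing.unit.
Proof. by move=> xK; apply: unitr_prod => i _; apply: unit_1Dexp; rewrite ?addn1. Qed.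

Lemma prod_even_unit x : x ^+ K = 0 -> prod_even x \is a GRing.unit.
Proof. by move=> xK; apply: unitr_prod => i _; apply: unit_1Dexp; rewrite ?addn2. Qed.

Lemma euler_unit x : x ^+ K = 0 -> euler x \is a GRing.unit.
Proof. by move=> xK; apply: (@qfact_unit _ _ K); apply: nilp_exp. Qed.

(** Scalars with product 1 keep the nome a pure power of [x]; roots of unity enter this way. *)
Lemma triple_productX (c d x : A) (a b n : nat) :
  c * d = 1 -> x ^+ K = 0 -> (0 < n)%N -> (a + b = n)%N ->
  theta (c * x ^+ a) (d * x ^+ b) K = qfact (x ^+ n) K *
  \prod_(i < K) ((1 + c * x ^+ (n * i + a)) * (1 + d * x ^+ (n * i + b))).
Proof.
move=> cd xK n0 abn.
have uw : c * x ^+ a * (d * x ^+ b) = x ^+ n by rewrite mulrACA cd mul1r -exprD abn.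
rewrite triple_product uw; last exact: nilp_exp.
congr (_ * _); apply: eq_bigr => i _.
by rewrite -!mulrA -!exprM -!exprD [(a + _)%N]addnC [(b + _)%N]addnC.
Qed.

(** The factor of exponent 0 yields the 2 in [Th1_prod] and the root-of-unity constants in
    [zeta_sum_prod1]. *)
Lemma prod_even_shift x (c : A) : x ^+ K = 0 ->
  \prod_(i < K) (1 + c * x ^+ (2 * i)) = (1 + c) * \prod_(i < K) (1 + c * x ^+ (2 * i + 2)).
Proof.
move=> xK; rewrite -(@prod_stable _ (fun i => 1 + c * x ^+ (2 * i)) K K.+1) //.
  rewrite big_ord_recl /= muln0 expr0 mulr1; congr (_ * _).
  by apply: eq_bigr => i _; rewrite /bump /=; congr (1 + c * x ^+ _); lia.
by move=> i Ki; rewrite (nilp_ge xK) ?mulr0 ?addr0 //; lia.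
Qed.

Lemma Th0_prod x : x ^+ K = 0 -> Th K 0 x = euler x * prod_odd x ^+ 2.
Proof.
move=> xK; have := @triple_productX 1 1 x 1 1 2 (mulr1 1) xK isT erefl.
rewrite !mul1r /Th => ->; rewrite big_split -[prod_odd x ^+ 2]/(prod_odd x * prod_odd x).
by congr (_ * (_ * _)); apply: eq_bigr => i _; rewrite mul1r.
Qed.

Lemma Th1_prod x : x ^+ K = 0 -> Th K 1 x = 2 * (euler x * prod_even x ^+ 2).
Proof.
move=> xK; have := @triple_productX 1 1 x 2 0 2 (mulr1 1) xK isT erefl.
rewrite !mul1r /Th => ->; rewrite big_split /=.
have -> : \prod_(i < K) (1 + 1 * x ^+ (2 * i + 0)) = \prod_(i < K) (1 + 1 * x ^+ (2 * i)).
  by apply: eq_bigr => i _; rewrite addn0.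
rewrite prod_even_shift // -/(euler x).
have -> : \prod_(i < K) (1 + 1 * x ^+ (2 * i + 2)) = prod_even x.
  by apply: eq_bigr => i _; rewrite mul1r.
ring.
Qed.

(** * Fifth roots of unity and product forms of the slices *)

Section Quintic.
Variables (z x : A).
Hypotheses (zE : 1 + z + z ^+ 2 + z ^+ 3 + z ^+ 4 = 0) (xK : x ^+ K = 0).

Lemma z5 : z ^+ 5 = 1.
Proof.
have -> : z ^+ 5 = 1 + (z - 1) * (1 + z + z ^+ 2 + z ^+ 3 + z ^+ 4) by ring.
by rewrite zE mulr0 addr0.
Qed.

(** For $c^5=1$ this is $c^j$ at any integer $j$, without inverses. *)
Definition zpow (c : A) (j : int) : A := c ^+ `|(j %% 5)%Z|%N.

Lemma zpowE c j n : c ^+ 5 = 1 -> (5 %| j - n%:Z)%Z -> zpow c j = c ^+ n.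
Proof.
move=> c5 jn; rewrite /zpow -[RHS](expr_mod _ c5); congr (_ ^+ _); lia.
Qed.

(** Here $c^4=c^{-1}$ and [tri j - tri (- j)] is $j$, so the scalars contribute $c^j$. *)
Lemma theta_termZ c e j : c ^+ 5 = 1 -> (e <= 1)%N ->
  theta_term (c * x ^+ (1 + e)) (c ^+ 4 * x ^+ (1 - e)) j =
  zpow c j * x ^+ `|(j * j + e%:Z * j)%R|%N.
Proof.
move=> c5 e1; rewrite -(@theta_termX _ _ (1 + e) (1 - e) j); last first.
  have [->|->] : (e = 0 \/ e = 1)%N by lia.
    rewrite addn0 subn0; ring.
  rewrite addn1 subnn; ring.
rewrite /theta_term !exprMn mulrACA; congr (_ * _).
rewrite -!exprD; symmetry; apply: zpowE => //.
by have := triE j; have := triE (- j); lia.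
Qed.

(** Weight the lattice sum by $z^{v_1+2v_2-e}$: the nonzero residues contribute $z+z^2+z^3+z^4=-1$
    times their common slice, while the weight factors over the two coordinates. *)
Lemma zeta_sum e : (e <= 1)%N ->
  slice x K e 0 - slice x K e (-1) = zpow z (- e%:Z) *
  (theta (z * x ^+ (1 + e)) (z ^+ 4 * x ^+ (1 - e)) K *
   theta (z ^+ 2 * x ^+ (1 + e)) (z ^+ 3 * x ^+ (1 - e)) K).
Proof.
move=> e1; have per i : zpow z (i + 5) = zpow z i.
  by rewrite /zpow; congr (_ ^+ _); lia.
have := sum_slices xK e1 per.
have -> : zpow z 1 + zpow z 2 + zpow z 3 + zpow z 4 = -1.
  rewrite /zpow /=; apply/eqP; rewrite -subr_eq0 -zE; apply/eqP; ring.
rewrite /zpow mod0z expr0 mul1r mulN1r => <-.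
have z3 : z ^+ 3 = (z ^+ 2) ^+ 4 by rewrite -exprM -[LHS]mulr1 -z5 -exprD.
rewrite z3 !theta_box big_box2 mulr_sumr; apply: eq_bigr => v _.
have z25 : (z ^+ 2) ^+ 5 = 1 by rewrite exprAC z5 expr1n.
rewrite !theta_termZ ?z5 // [in RHS]mulrACA -[X in _ = _ * (_ * X)]exprD [RHS]mulrA; congr (_ * _ ^+ _).
  rewrite /zpow -exprM -!exprD -[LHS](expr_mod _ z5) -[RHS](expr_mod _ z5).
  by congr (_ ^+ _); lia.
rewrite /qform.
have [] := sq_ge e1 v.1; have [] := sq_ge e1 v.2; lia.
Qed.

Lemma slice0_Th e : (e <= 1)%N -> slice x K e 0 = x ^+ (2 * e) * Th K e (x ^+ 5) ^+ 2.
Proof.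
move=> e1; rewrite slice0 // Th_sq // mulr_sumr; apply: eq_bigr => v _.
rewrite -exprM -exprD; congr (_ ^+ _); have := qform_ge0 e1 v; lia.
Qed.

Lemma slice1_theta e : (e <= 1)%N -> slice x K e (-1) = x ^+ (1 - e) *
  (theta (x ^+ (5 * e + 3)) (x ^+ (7 - 5 * e)) K *
   theta (x ^+ (5 * e + 1)) (x ^+ (9 - 5 * e)) K).
Proof.
move=> e1; rewrite slice1 // !theta_box big_box2 mulr_sumr; apply: eq_bigr => v _.
rewrite (@theta_termX _ _ _ _ _ (5 * (v.1 * v.1) + (5 * e%:Z - 2) * v.1)); last first.
  have [->|->] : (e = 0 \/ e = 1)%N by lia.
    lia.
  lia.
rewrite (@theta_termX _ _ _ _ _ (5 * (v.2 * v.2) + (5 * e%:Z - 4) * v.2)); last first.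
  have [->|->] : (e = 0 \/ e = 1)%N by lia.
    lia.
  lia.
rewrite -!exprD /qform1; congr (_ ^+ _).
have [+ _] := sq1_ge e1 v.1; have [_] := sq1_ge e1 v.2.
by move: (5 * (v.1 * v.1) + (_ - 2) * _) (5 * (v.2 * v.2) + (_ - 4) * _) => a b; lia.
Qed.

Lemma Th_slices e : (e <= 1)%N -> Th K e x ^+ 2 = slice x K e 0 + 4 * slice x K e (-1).
Proof.
move=> e1; have := @sum_slices _ x K e xK e1 (fun=> 1) (fun=> erefl).
rewrite Th_sq // mul1r => E; transitivity (\sum_(v <- box2 K) 1 * x ^+ `|qform e v|%N).
  by apply: eq_bigr => v _; rewrite mul1r.
rewrite E; ring.
Qed.

Lemma cyclotomic5 (y : A) :
  (1 + z * y) * (1 + z ^+ 4 * y) * ((1 + z ^+ 2 * y) * (1 + z ^+ 3 * y)) * (1 + y) = 1 + y ^+ 5.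
Proof.
have -> : (1 + z * y) * (1 + z ^+ 4 * y) = 1 + (z + z ^+ 4) * y + z ^+ 5 * y ^+ 2 by ring.
have -> : (1 + z ^+ 2 * y) * (1 + z ^+ 3 * y) = 1 + (z ^+ 2 + z ^+ 3) * y + z ^+ 5 * y ^+ 2 by ring.
rewrite z5.
(* The quadratic periods $z+z^4$ and $z^2+z^3$ have sum and product $-1$. *)
have ts : z ^+ 2 + z ^+ 3 = -1 - (z + z ^+ 4).
  by apply/eqP; rewrite -subr_eq0 -zE; apply/eqP; ring.
have st : (z + z ^+ 4) * (z ^+ 2 + z ^+ 3) = -1.
  have -> : (z + z ^+ 4) * (z ^+ 2 + z ^+ 3) = z ^+ 5 * z + z ^+ 5 * z ^+ 2 + z ^+ 3 + z ^+ 4 by ring.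
  by rewrite z5; apply/eqP; rewrite -subr_eq0 -zE; apply/eqP; ring.
rewrite ts in st *; move: (z + z ^+ 4) st => s st.
transitivity ((1 - y + (1 + 1 + s * (-1 - s)) * y ^+ 2 - y ^+ 3 + y ^+ 4) * (1 + y)); first by ring.
rewrite st; ring.
Qed.

Lemma prod_blocks5 d : (0 < d)%N ->
  \prod_(i < K) (1 + x ^+ (2 * i + d)) =
  \prod_(i < K) ((1 + x ^+ (10 * i + d)) * (1 + x ^+ (10 * i + 2 + d)) * (1 + x ^+ (10 * i + 4 + d))
    * (1 + x ^+ (10 * i + 6 + d)) * (1 + x ^+ (10 * i + 8 + d))).
Proof.
move=> d0; rewrite -(@prod_stable _ (fun i => 1 + x ^+ (2 * i + d)) K (5 * K)); last 2 first.
- by move=> i Ki; rewrite (nilp_ge xK) ?addr0 //; lia.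
- lia.
rewrite (prod_blocks (fun i => 1 + x ^+ (2 * i + d))); apply: eq_bigr => i _; rewrite !big_ord_recr big_ord0 /= mul1r.
by do !congr (_ * _); congr (1 + x ^+ _); lia.
Qed.

(** Modulo 10 the two theta series supply the exponents 3, 7, 1, 9, and [prod_odd (x ^+ 5)] the
    missing 5. *)
Lemma slice1_prod0 :
  slice x K 0 (-1) * prod_odd (x ^+ 5) = x * euler (x ^+ 5) ^+ 2 * prod_odd x.
Proof.
have := @triple_productX 1 1 x 3 7 10 (mulr1 1) xK isT erefl.
have := @triple_productX 1 1 x 1 9 10 (mulr1 1) xK isT erefl.
rewrite !mul1r slice1_theta // => E1 E3; rewrite /= E1 E3.
have -> : qfact (x ^+ 10) K = euler (x ^+ 5) by rewrite /euler -exprM.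
have <- : \prod_(i < K) ((1 + 1 * x ^+ (10 * i + 3)) * (1 + 1 * x ^+ (10 * i + 7))) *
    \prod_(i < K) ((1 + 1 * x ^+ (10 * i + 1)) * (1 + 1 * x ^+ (10 * i + 9))) *
    prod_odd (x ^+ 5) = prod_odd x; last by rewrite subn0 expr1; ring.
rewrite /prod_odd (@prod_blocks5 1) // -!big_split; apply: eq_bigr => i _ /=; rewrite -exprM !mul1r.
rewrite (_ : 10 * i + 2 + 1 = 10 * i + 3)%N; last by lia.
rewrite (_ : 10 * i + 4 + 1 = 5 * (2 * i + 1))%N; last by lia.
rewrite (_ : 10 * i + 6 + 1 = 10 * i + 7)%N; last by lia.
rewrite (_ : 10 * i + 8 + 1 = 10 * i + 9)%N; last by lia.
ring.
Qed.

Lemma slice1_prod1 :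
  slice x K 1 (-1) * prod_even (x ^+ 5) = euler (x ^+ 5) ^+ 2 * prod_even x.
Proof.
have := @triple_productX 1 1 x 8 2 10 (mulr1 1) xK isT erefl.
have := @triple_productX 1 1 x 6 4 10 (mulr1 1) xK isT erefl.
rewrite !mul1r slice1_theta // => E1 E3; rewrite /= E1 E3.
have -> : qfact (x ^+ 10) K = euler (x ^+ 5) by rewrite /euler -exprM.
have <- : \prod_(i < K) ((1 + 1 * x ^+ (10 * i + 8)) * (1 + 1 * x ^+ (10 * i + 2))) *
    \prod_(i < K) ((1 + 1 * x ^+ (10 * i + 6)) * (1 + 1 * x ^+ (10 * i + 4))) *
    prod_even (x ^+ 5) = prod_even x; last by rewrite subnn expr0; ring.
rewrite /prod_even (@prod_blocks5 2) // -!big_split; apply: eq_bigr => i _ /=; rewrite -exprM !mul1r.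
rewrite (_ : 10 * i + 2 + 2 = 10 * i + 4)%N; last by lia.
rewrite (_ : 10 * i + 4 + 2 = 10 * i + 6)%N; last by lia.
rewrite (_ : 10 * i + 6 + 2 = 10 * i + 8)%N; last by lia.
rewrite (_ : 10 * i + 8 + 2 = 5 * (2 * i + 2))%N; last by lia.
ring.
Qed.

(** The theta series supply the factors twisted by $z, z^4, z^2, z^3$ and [prod_odd x] the untwisted
    one; [cyclotomic5] multiplies the five. *)
Lemma zeta_sum_prod0 :
  (slice x K 0 0 - slice x K 0 (-1)) * prod_odd x = euler x ^+ 2 * prod_odd (x ^+ 5).
Proof.
have z4 : z * z ^+ 4 = 1 by rewrite -exprS z5.
have z23 : z ^+ 2 * z ^+ 3 = 1 by rewrite -exprD z5.
rewrite zeta_sum // /zpow mod0z expr0 mul1r.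
rewrite (@triple_productX _ _ x (1 + 0) (1 - 0) 2 z4) //.
rewrite (@triple_productX _ _ x (1 + 0) (1 - 0) 2 z23) // -/(euler x).
rewrite mulrACA -expr2 -mulrA; congr (_ * _).
rewrite /prod_odd -!big_split; apply: eq_bigr => i _ /=; rewrite exprAC.
exact: cyclotomic5.
Qed.

Lemma zeta_sum_prod1 :
  (slice x K 1 0 - slice x K 1 (-1)) * prod_even x = - (euler x ^+ 2 * prod_even (x ^+ 5)).
Proof.
have z4 : z * z ^+ 4 = 1 by rewrite -exprS z5.
have z23 : z ^+ 2 * z ^+ 3 = 1 by rewrite -exprD z5.
rewrite zeta_sum // /zpow.
rewrite (@triple_productX _ _ x 2 0 2 z4) //.
rewrite (@triple_productX _ _ x 2 0 2 z23) // -/(euler x).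
have shift (c d : A) : \prod_(i < K) ((1 + c * x ^+ (2 * i + 2)) * (1 + d * x ^+ (2 * i + 0))) =
    (1 + d) * \prod_(i < K) ((1 + c * x ^+ (2 * i + 2)) * (1 + d * x ^+ (2 * i + 2))).
  rewrite !big_split /=.
  have -> : \prod_(i < K) (1 + d * x ^+ (2 * i + 0)) = \prod_(i < K) (1 + d * x ^+ (2 * i)).
    by apply: eq_bigr => i _; rewrite addn0.
  rewrite prod_even_shift //; ring.
rewrite !shift.
have <- : (\prod_(i < K) ((1 + z * x ^+ (2 * i + 2)) * (1 + z ^+ 4 * x ^+ (2 * i + 2)))) *
    (\prod_(i < K) ((1 + z ^+ 2 * x ^+ (2 * i + 2)) * (1 + z ^+ 3 * x ^+ (2 * i + 2)))) *
    prod_even x = prod_even (x ^+ 5).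
  rewrite /prod_even -!big_split; apply: eq_bigr => i _ /=; rewrite exprAC.
  exact: cyclotomic5.
(* The factors of exponent 0 and the prefactor $z^{-1}$ give $z^4(1+z^4)(1+z^3)=z^4+z^3+z^2+z$,
   whence the minus sign. *)
have e : z ^+ `|(- 1%N%:Z %% 5)%Z|%N * (1 + z ^+ 4) * (1 + z ^+ 3) = -1.
  rewrite /=.
  have -> : z ^+ 4 * (1 + z ^+ 4) * (1 + z ^+ 3) = z ^+ 5 * (z ^+ 2 + z ^+ 3 + z ^+ 5 * z) + z ^+ 4 by ring.
  rewrite z5; apply/eqP; rewrite -subr_eq0 -zE; apply/eqP; ring.
rewrite -[RHS]mulN1r -e; ring.
Qed.
End Quintic.
End Products.

(** * The modular equation *)

Section ModularEquation.
Variables (A : comUnitRingType) (K : nat) (z : A).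
Hypothesis zE : 1 + z + z ^+ 2 + z ^+ 3 + z ^+ 4 = 0.

Definition eta_prod (x : A) := euler K x ^+ 2 * euler K (x ^+ 5) ^+ 2.

Lemma Th0_quintic (x : A) : x ^+ K = 0 ->
  (Th K 0 x ^+ 2 - Th K 0 (x ^+ 5) ^+ 2) * (5 * Th K 0 (x ^+ 5) ^+ 2 - Th K 0 x ^+ 2) =
  16 * x * eta_prod x.
Proof.
move=> xK; have x5K : (x ^+ 5) ^+ K = 0 by apply: nilp_exp.
have E1 := slice1_prod0 xK; have E2 := zeta_sum_prod0 zE xK.
have := slice0_Th xK (e := 0) isT; rewrite mul1r => <-.
rewrite (Th_slices xK) //; move: E1 E2; set s := slice x K 0 0; set t := slice x K 0 _ => E1 E2.
(* The brackets are $4t$ and $4(s-t)$; the two units bring in the products that [E1] and [E2]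
   require. *)
apply: (mulIr (prod_odd_unit x5K)); apply: (mulIr (prod_odd_unit xK)).
transitivity (16 * (t * prod_odd K (x ^+ 5)) * ((s - t) * prod_odd K x)); first by ring.
rewrite E1 E2 /eta_prod; ring.
Qed.

Lemma Th1_quintic (x : A) : x ^+ K = 0 ->
  (Th K 1 x ^+ 2 - x ^+ 2 * Th K 1 (x ^+ 5) ^+ 2) *
    (5 * (x ^+ 2 * Th K 1 (x ^+ 5) ^+ 2) - Th K 1 x ^+ 2) =
  - (16 * eta_prod x).
Proof.
move=> xK; have x5K : (x ^+ 5) ^+ K = 0 by apply: nilp_exp.
have E1 := slice1_prod1 xK; have E2 := zeta_sum_prod1 zE xK.
have := slice0_Th xK (e := 1) isT; rewrite muln1 => <-.
rewrite (Th_slices xK) //; move: E1 E2; set s := slice x K 1 0; set t := slice x K 1 _ => E1 E2.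
apply: (mulIr (prod_even_unit x5K)); apply: (mulIr (prod_even_unit xK)).
transitivity (16 * (t * prod_even K (x ^+ 5)) * ((s - t) * prod_even K x)); first by ring.
rewrite E1 E2 /eta_prod; ring.
Qed.

Lemma eulerN (x : A) : euler K (- x) = euler K x.
Proof. by rewrite /euler sqrrN. Qed.

(** The factor 6 stays, as it may fail to be invertible in [A]; it is cancelled only between integer
    coefficients. *)
Lemma modular_equation5 (x : A) : x ^+ K = 0 ->
  6 * (prod_odd K x ^+ 4 * prod_odd K (x ^+ 5) ^+ 4
       - prod_odd K (- x) ^+ 4 * prod_odd K (- x ^+ 5) ^+ 4) =
  6 * (16 * (x ^+ 3 * (prod_even K x ^+ 4 * prod_even K (x ^+ 5) ^+ 4)) + 8 * x).
Proof.
move=> xK; have x5K : (x ^+ 5) ^+ K = 0 by apply: nilp_exp.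
have NK (y : A) : y ^+ K = 0 -> (- y) ^+ K = 0 by move=> yK; rewrite exprNn yK mulr0.
have Hu : eta_prod x \is a GRing.unit by rewrite unitrM !unitrX ?euler_unit.
have xN5 : (- x) ^+ 5 = - x ^+ 5 by ring.
have Q1 := Th0_quintic xK; have Q2 := Th1_quintic xK.
have := Th0_quintic (NK _ xK); rewrite xN5 /eta_prod eulerN xN5 eulerN -/(eta_prod x) => Q3.
have J1 := jacobi_quartic xK; have J5 := jacobi_quartic x5K.
have P0 y : y ^+ K = 0 -> Th K 0 y ^+ 2 = euler K y ^+ 2 * prod_odd K y ^+ 4.
  by move=> yK; rewrite Th0_prod //; ring.
have P1 y : y ^+ K = 0 -> Th K 1 y ^+ 2 = 4 * (euler K y ^+ 2 * prod_even K y ^+ 4).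
  by move=> yK; rewrite Th1_prod //; ring.
have M : 6 * (Th K 0 x ^+ 2 * Th K 0 (x ^+ 5) ^+ 2 - Th K 0 (- x) ^+ 2 * Th K 0 (- x ^+ 5) ^+ 2
    - x ^+ 3 * (Th K 1 x ^+ 2 * Th K 1 (x ^+ 5) ^+ 2)) = 48 * x * eta_prod x.
  move: Q1 Q2 Q3 J1 J5; move: (Th K 0 x) (Th K 0 (x ^+ 5)) (Th K 0 (- x)) (Th K 0 (- x ^+ 5)).
  move: (Th K 1 x) (Th K 1 (x ^+ 5)) (eta_prod x) => p p5 H a a5 b b5 Q1 Q2 Q3 J1 J5.
  (* The quartics, with weights 1 at [x] and 5 at [x ^+ 5], absorb all pure fourth powers; each of
     the three quintic relations then contributes [16 * x * H]. *)
  transitivity ((a ^+ 2 - a5 ^+ 2) * (5 * a5 ^+ 2 - a ^+ 2) + (a ^+ 4 - b ^+ 4 - x * p ^+ 4)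
    + 5 * (a5 ^+ 4 - b5 ^+ 4 - x ^+ 5 * p5 ^+ 4)
    - (b ^+ 2 - b5 ^+ 2) * (5 * b5 ^+ 2 - b ^+ 2)
    - x * ((p ^+ 2 - x ^+ 2 * p5 ^+ 2) * (5 * (x ^+ 2 * p5 ^+ 2) - p ^+ 2))); first by ring.
  rewrite Q1 Q2 Q3 J1 J5; ring.
apply: (mulrI Hu); move: M.
rewrite !P0 ?NK // !P1 // !eulerN => M.
transitivity (6 * (euler K x ^+ 2 * prod_odd K x ^+ 4 * (euler K (x ^+ 5) ^+ 2 * prod_odd K (x ^+ 5) ^+ 4) -
  euler K x ^+ 2 * prod_odd K (- x) ^+ 4 *
     (euler K (x ^+ 5) ^+ 2 * prod_odd K (- x ^+ 5) ^+ 4) -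
     x ^+ 3 *
     (4 * (euler K x ^+ 2 * prod_even K x ^+ 4) *
      (4 * (euler K (x ^+ 5) ^+ 2 * prod_even K (x ^+ 5) ^+ 4)))) +
  96 * x ^+ 3 * (euler K x ^+ 2 * prod_even K x ^+ 4 * (euler K (x ^+ 5) ^+ 2 * prod_even K (x ^+ 5) ^+ 4))).
  by rewrite /eta_prod; ring.
rewrite M /eta_prod; ring.
Qed.
End ModularEquation.

(** * Generating polynomials *)

(** Expand the product over all copies: [s] marks the number of parts and [y] their sum. *)
Lemma sum_copies (A : comPzRingType) (s y : A) mult N : (forall v, mult v <= 8)%N ->
  \sum_(B : {set copy mult N}) s ^+ #|B| * y ^+ (\sum_(c in B) copy_val c) =
  \prod_(v < N.+1) (1 + s * y ^+ v) ^+ mult v.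
Proof.
move=> m8; transitivity (\prod_(c : copy mult N) (s * y ^+ copy_val c + 1)).
  rewrite bigA_distr; apply: eq_bigr => B _.
  rewrite -big_mkcond /= big_split /= prodr_const; congr (_ * _).
  by rewrite -prodrXr.
transitivity (\prod_(p : 'I_N.+1 * 'I_8 | (p.2 < mult p.1)%N) (s * y ^+ p.1 + 1)).
  symmetry.
  exact: (big_sub (fun p : 'I_N.+1 * 'I_8 => p.2 < mult p.1)%N (fun p => s * y ^+ p.1 + 1)).
rewrite -(pair_big_dep xpredT (fun (i : 'I_N.+1) (j : 'I_8) => j < mult i)%N
  (fun i _ => s * y ^+ i + 1)) /=.
apply: eq_bigr => v _; rewrite prodr_const addrC; congr (_ ^+ _).
rewrite -sum1_card -(big_ord_widen _ (fun=> 1%N)) ?sum_nat_const ?card_ord ?muln1 //.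
Qed.

Section GeneratingPolynomial.
Variables (R : comNzRingType) (mult : nat -> nat).
Hypothesis mult8 : forall v, (mult v <= 8)%N.

Definition gen_poly (s : R) n : {poly R} := \prod_(v < n) (1 + s *: 'X^v) ^+ mult v.

(** The type [copy mult N] varies with [N]; this lets one polynomial serve several coefficients. *)
Lemma gen_poly_stable s N n : (N < n)%N -> (gen_poly s n)`_N = (gen_poly s N.+1)`_N.
Proof.
elim: n => // n IH; rewrite ltnS leq_eqVlt => /predU1P[-> //|Nn].
rewrite -{}IH // /gen_poly big_ord_recr /=; set p := \prod_(_ < _) _.
elim: (mult n) => [|k IHk]; first by rewrite expr0 mulr1.
rewrite exprSr mulrA mulrDr mulr1 coefD IHk -scalerAr coefZ coefMXn Nn mulr0 addr0 //.
Qed.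

Lemma coef_gen_poly s N n : (N < n)%N ->
  (gen_poly s n)`_N = \sum_(B in partitions mult N) s ^+ #|B|.
Proof.
move=> Nn; rewrite gen_poly_stable //.
have -> : gen_poly s N.+1 = \prod_(v < N.+1) (1 + s%:P * 'X ^+ v) ^+ mult v.
  by apply: eq_bigr => v _; rewrite mul_polyC.
rewrite -sum_copies // coef_sum [RHS]big_mkcond; apply: eq_bigr => B _.
by rewrite inE -polyC_exp coefCM coefXn eq_sym; case: eqP => _; rewrite ?mulr1 ?mulr0.
Qed.

Lemma coef_gen_poly1 N n : (N < n)%N -> (gen_poly 1 n)`_N = (Dpart mult N)%:R.
Proof.
move=> Nn; rewrite coef_gen_poly //.
by under eq_bigr do rewrite expr1n; rewrite sumr_const.
Qed.

Lemma coef_gen_polyB N n : (N < n)%N ->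
  (gen_poly 1 n - gen_poly (-1) n)`_N = (2 * Dpart_odd mult N)%:R.
Proof.
move=> Nn; rewrite coefB !coef_gen_poly // -sumrB.
rewrite natrM mulr_natr -sumr_const [LHS]big_mkcond [RHS]big_mkcond /=.
apply: eq_bigr => B _; rewrite [in RHS]inE expr1n -signr_odd; case: (B \in _) => //=.
by case: odd; rewrite ?expr1 ?opprK ?subrr.
Qed.
End GeneratingPolynomial.

(** * Product formulas for the two multisets *)

Lemma prod_shift_blocks (A : comPzRingType) (mult : nat -> nat) (f : nat -> A) n : mult 0%N = 0%N ->
  \prod_(v < (10 * n).+1) f v ^+ mult v =
  \prod_(i < n) \prod_(r < 10) f (10 * i + r).+1 ^+ mult (10 * i + r).+1.
Proof.
move=> m0; rewrite big_ord_recl m0 expr0 mul1r.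
exact: (prod_blocks (fun v => f v.+1 ^+ mult v.+1)).
Qed.

(** Multiplicities have period 10 at positive values, and 8 copies split as 4 + 4. *)
Lemma multS_prod (A : comPzRingType) (f : nat -> A) n :
  \prod_(v < (10 * n).+1) f v ^+ multS v =
  (\prod_(i < 5 * n) f (2 * i + 1)%N) ^+ 4 * (\prod_(i < n) f (5 * (2 * i + 1))%N) ^+ 4.
Proof.
rewrite prod_shift_blocks // (prod_blocks (fun i => f (2 * i + 1)%N)).
rewrite -!prodrXl -big_split; apply: eq_bigr => i _.
have multE r : multS (10 * i + r).+1 = multS r.+1.
  by rewrite /multS; do !case: ifP; lia.
under eq_bigr do rewrite multE.
rewrite !big_ord_recr !big_ord0 /=.
have E (k l : nat) : k = l -> f k = f l by move=> ->.
rewrite !(expr0, mul1r, mulr1).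
rewrite (E (2 * (5 * i + 0) + 1)%N (10 * i + 0).+1); last lia.
rewrite (E (2 * (5 * i + 1) + 1)%N (10 * i + 2).+1); last lia.
rewrite (E (2 * (5 * i + 2) + 1)%N (10 * i + 4).+1); last lia.
rewrite (E (2 * (5 * i + 3) + 1)%N (10 * i + 6).+1); last lia.
rewrite (E (2 * (5 * i + 4) + 1)%N (10 * i + 8).+1); last lia.
rewrite (E (5 * (2 * i + 1))%N (10 * i + 4).+1); last lia.
rewrite /multS /=; ring.
Qed.

Lemma multT_prod (A : comPzRingType) (f : nat -> A) n :
  \prod_(v < (10 * n).+1) f v ^+ multT v =
  (\prod_(i < 5 * n) f (2 * i + 2)%N) ^+ 4 * (\prod_(i < n) f (5 * (2 * i + 2))%N) ^+ 4.
Proof.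
rewrite prod_shift_blocks // (prod_blocks (fun i => f (2 * i + 2)%N)).
rewrite -!prodrXl -big_split; apply: eq_bigr => i _.
have multE r : multT (10 * i + r).+1 = multT r.+1.
  by rewrite /multT; do !case: ifP; lia.
under eq_bigr do rewrite multE.
rewrite !big_ord_recr !big_ord0 /=.
have E (k l : nat) : k = l -> f k = f l by move=> ->.
rewrite !(expr0, mul1r, mulr1).
rewrite (E (2 * (5 * i + 0) + 2)%N (10 * i + 1).+1); last lia.
rewrite (E (2 * (5 * i + 1) + 2)%N (10 * i + 3).+1); last lia.
rewrite (E (2 * (5 * i + 2) + 2)%N (10 * i + 5).+1); last lia.
rewrite (E (2 * (5 * i + 3) + 2)%N (10 * i + 7).+1); last lia.
rewrite (E (2 * (5 * i + 4) + 2)%N (10 * i + 9).+1); last lia.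
rewrite (E (5 * (2 * i + 2))%N (10 * i + 9).+1); last lia.
rewrite /multT /=; ring.
Qed.

Lemma multS_le8 v : (multS v <= 8)%N.
Proof. by rewrite /multS; case: odd => //; case: ifP. Qed.

Lemma multT_le8 v : (multT v <= 8)%N.
Proof. by rewrite /multT; case: (_ && _) => //; case: ifP. Qed.

Section Nilpotent.
Variables (A : comUnitRingType) (K : nat) (x : A).
Hypothesis xK : x ^+ K = 0.

Lemma multS_prod_nilp :
  \prod_(v < (10 * K).+1) (1 + x ^+ v) ^+ multS v =
  prod_odd K x ^+ 4 * prod_odd K (x ^+ 5) ^+ 4.
Proof.
rewrite (multS_prod (fun v => 1 + x ^+ v)); congr (_ ^+ _ * _ ^+ _).
  rewrite (@prod_stable _ (fun i => 1 + x ^+ (2 * i + 1)) K) //; last lia.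
  by move=> i Ki; rewrite (nilp_ge xK) ?addr0 //; lia.
by apply: eq_bigr => i _; rewrite exprM.
Qed.

(** All elements of $S$ are odd, so the sign counting parts is the sign of $x \mapsto -x$. *)
Lemma multS_prodN :
  \prod_(v < (10 * K).+1) (1 - x ^+ v) ^+ multS v =
  \prod_(v < (10 * K).+1) (1 + (- x) ^+ v) ^+ multS v.
Proof.
apply: eq_bigr => v _; rewrite exprNn -signr_odd /multS.
by case: odd; rewrite ?mulN1r ?expr0.
Qed.

Lemma multT_prod_nilp :
  \prod_(v < (10 * K).+1) (1 + x ^+ v) ^+ multT v =
  prod_even K x ^+ 4 * prod_even K (x ^+ 5) ^+ 4.
Proof.
rewrite (multT_prod (fun v => 1 + x ^+ v)); congr (_ ^+ _ * _ ^+ _).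
  rewrite (@prod_stable _ (fun i => 1 + x ^+ (2 * i + 2)) K) //; last lia.
  by move=> i Ki; rewrite (nilp_ge xK) ?addr0 //; lia.
by apply: eq_bigr => i _; rewrite exprM.
Qed.
End Nilpotent.

(** * Transfer to the quotient ring and comparison of coefficients *)

Lemma rmorph_gen_poly (R : comNzRingType) (A : comPzRingType) (h : {rmorphism {poly R} -> A}) mult s n :
  h (gen_poly mult s n) = \prod_(v < n) (1 + h s%:P * h 'X ^+ v) ^+ mult v.
Proof.
rewrite rmorph_prod; apply: eq_bigr => v _.
by rewrite rmorphXn rmorphD rmorph1 -mul_polyC rmorphM rmorphXn.
Qed.

Lemma in_qpolyXn_eq0 (R : comNzRingType) K (p : {poly R}) (i : nat) :
  in_qpoly 'X^(K.+1) p = 0 -> (i <= K)%N -> p`_i = 0.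
Proof.
move=> /(congr1 val) /= p0 iK.
rewrite (Pdiv.RingMonic.rdivp_eq (monicXn _ K.+1) p).
rewrite mk_monic_Xn /= in p0; rewrite p0 addr0 coefMXn ltnS iK //.
Qed.

Lemma gen_poly_identity n N : (N < n)%N ->
  (6 * (gen_poly multS 1 (10 * n).+1 - gen_poly multS (-1) (10 * n).+1) : {poly algC})`_N =
  (6 * (16 * ('X^3 * gen_poly multT 1 (10 * n).+1) + 8 * 'X))`_N.
Proof.
case: n => // n Nn.
(* [algC] offers a primitive fifth root of unity and, for the final comparison of integers,
   characteristic 0. *)
have [z zP] := C_prim_root_exists (isT : 0 < 5)%N.
have zE : 1 + z + z ^+ 2 + z ^+ 3 + z ^+ 4 = 0.
  have z1 : z - 1 != 0.
    by rewrite subr_eq0; apply/eqP => z1; have := prim_order_dvd zP 1; rewrite z1 expr1 eqxx.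
  apply: (mulfI z1); rewrite mulr0; transitivity (z ^+ 5 - 1); first by ring.
  by rewrite (prim_expr_order zP) subrr.
pose pi : {rmorphism {poly algC} -> {poly %/ 'X^(n.+1)}} := in_qpoly 'X^(n.+1); pose x := pi 'X.
have xn : x ^+ n.+1 = 0.
  rewrite -rmorphXn; apply: val_inj => /=.
  by rewrite mk_monic_Xn; apply/eqP; apply: Pdiv.RingMonic.rdvdpp; apply: monicXn.
have zE' : 1 + pi z%:P + pi z%:P ^+ 2 + pi z%:P ^+ 3 + pi z%:P ^+ 4 = 0.
  have := congr1 (fun c => pi c%:P) zE.
  by rewrite !polyCD !polyC_exp polyC1 polyC0 !rmorphD !rmorphXn rmorph1 rmorph0.
have M := modular_equation5 zE' xn.
have piS : pi (gen_poly multS 1 (10 * n.+1).+1) =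
    prod_odd n.+1 x ^+ 4 * prod_odd n.+1 (x ^+ 5) ^+ 4.
  rewrite -multS_prod_nilp // rmorph_gen_poly; apply: eq_bigr => v _.
  by rewrite rmorph1 mul1r.
have piSN : pi (gen_poly multS (-1) (10 * n.+1).+1) =
    prod_odd n.+1 (- x) ^+ 4 * prod_odd n.+1 (- x ^+ 5) ^+ 4.
  have e : - x ^+ 5 = (- x) ^+ 5 by ring.
  rewrite e -multS_prod_nilp; last by rewrite exprNn xn mulr0.
  rewrite -multS_prodN rmorph_gen_poly; apply: eq_bigr => v _.
  by rewrite polyCN rmorphN rmorph1 mulN1r.
have piT : pi (gen_poly multT 1 (10 * n.+1).+1) =
    prod_even n.+1 x ^+ 4 * prod_even n.+1 (x ^+ 5) ^+ 4.
  rewrite -multT_prod_nilp // rmorph_gen_poly; apply: eq_bigr => v _.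
  by rewrite rmorph1 mul1r.
rewrite -piS -piSN -piT in M.
apply/eqP; rewrite -subr_eq0 -coefB; apply/eqP.
apply: (@in_qpolyXn_eq0 _ n); last by rewrite -ltnS.
rewrite -/(pi _) rmorphB; apply/eqP; rewrite subr_eq0; apply/eqP.
by rewrite !(rmorph_nat, rmorphXn, rmorphB, rmorphM, rmorphD).
Qed.

Local Close Scope ring_scope.

Theorem theorem3p11 (N : nat) : 3 <= N ->
  Dpart_odd multS N = 8 * Dpart multT (N - 3).
Proof.
move=> N3; have := gen_poly_identity (ltnSn N); set m := (10 * N.+1).+1.
have Nm : (N < m)%N by rewrite /m; lia.
have N3m : (N - 3 < m)%N by rewrite /m; lia.
(* At degree [N >= 3] the term [8 * 'X] vanishes and ['X^3] shifts to [N - 3], leaving $6 \cdot 2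
   D_S(N) = 6 \cdot 16 D_T(N-3)$. *)
rewrite -/m !mulr_natl !coefMn (@coef_gen_polyB _ _ multS_le8) // coefD !coefMn.
rewrite coefXnM coefX.
rewrite ltnNge N3 /= (@coef_gen_poly1 _ _ multT_le8) //.
have -> : (N == 1)%N = false by lia.
rewrite mul0rn addr0 -!mulrnA => /eqP; rewrite eqr_nat => /eqP; lia.
Qed.
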